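(* Let $f:\mathbb{R}^n\to\mathbb{R}$ be convex and differentiable, let $g:\mathbb{R}^n\to\mathbb{R}$, and set $\zeta=f+g$. Assume: (i) $\zeta$ is bounded below; (ii) $g$ is proper, lower semicontinuous, finite-valued, weakly convex with modulus $\sigma_g>0$, and directionally differentiable; (iii) $\nabla f$ is Lipschitz continuous with constant $\mathrm{Lip}_{\nabla f}>0$, i.e. $\|\nabla f(\mathbf{x})-\nabla f(\mathbf{y})\|_2\le \mathrm{Lip}_{\nabla f}\|\mathbf{x}-\mathbf{y}\|_2$ for all $\mathbf{x},\mathbf{y}\in\mathbb{R}^n$. Let $\{(\mathbf{x}^t,\mathbf{z}^t,\mathbf{v}^t)\}_{t\ge 0}$ be generated by LADMM with parameter $\rho$, and for $t\ge 1$ define $$\kappa_t=\mathcal{L}(\mathbf{x}^t,\mathbf{z}^t;\mathbf{v}^t)+\mathrm{Lip}_{\nabla f}^2\,\|\mathbf{z}^t-\mathbf{z}^{t-1}\|_2^2 .$$ If $\rho>\max\{\sigma_g,\;1+\mathrm{Lip}_{\nabla f},\;\mathrm{Lip}_{\nabla f}(1+2\,\mathrm{Lip}_{\nabla f})\}$, then the sequence $\{\kappa_t\}_{t=1}^\infty$ is monotonically decreasing and bounded below.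
   Context: ''Monotonically decreasing'' is in the non-strict sense: $\kappa_{t+1}\le\kappa_t$ for all $t\ge 1$. Weak convexity: $g$ is weakly convex with modulus $\sigma_g>0$ if $g(\mathbf{x})+\frac{\sigma_g}{2}\|\mathbf{x}\|_2^2$ is convex. Directional differentiability: $g$ is directionally differentiable if $g'(\mathbf{x};\mathbf{d})=\lim_{\tau\downarrow 0}\frac{g(\mathbf{x}+\tau\mathbf{d})-g(\mathbf{x})}{\tau}$ exists for all $\mathbf{x},\mathbf{d}$. Augmented Lagrangian, for $\rho>0$: $\mathcal{L}(\mathbf{x},\mathbf{z};\mathbf{v})=f(\mathbf{z})+g(\mathbf{x})+\rho\langle\mathbf{v},\mathbf{x}-\mathbf{z}\rangle+\frac{\rho}{2}\|\mathbf{x}-\mathbf{z}\|_2^2$ for $\mathbf{x},\mathbf{z},\mathbf{v}\in\mathbb{R}^n$. LADMM (linearized ADMM) iterations: given an arbitrary initial point $(\mathbf{x}^0,\mathbf{z}^0,\mathbf{v}^0)$, for $t=0,1,2,\dots$, $\mathbf{x}^{t+1}\in\arg\min_{\mathbf{x}}\mathcal{L}(\mathbf{x},\mathbf{z}^t;\mathbf{v}^t)$, $\mathbf{z}^{t+1}\in\arg\min_{\mathbf{z}}\{f(\mathbf{z}^t)+\langle\nabla f(\mathbf{z}^t),\mathbf{z}-\mathbf{z}^t\rangle+\frac{\rho}{2}\|\mathbf{x}^{t+1}-\mathbf{z}+\mathbf{v}^t\|_2^2\}$, i.e. $\mathbf{z}^{t+1}=\mathbf{x}^{t+1}+\mathbf{v}^t-\frac{1}{\rho}\nabla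 f(\mathbf{z}^t)$, $\mathbf{v}^{t+1}=\mathbf{v}^t+\mathbf{x}^{t+1}-\mathbf{z}^{t+1}$. *)

(* Defs.v *)
From HB Require Import structures.
From mathcomp Require Import all_boot all_order all_algebra.
From mathcomp Require Import all_classical all_reals all_analysis.

Set Implicit Arguments.
Unset Strict Implicit.
Unset Printing Implicit Defensive.

Import Order.TTheory GRing.Theory Num.Theory.
Import numFieldNormedType.Exports.

Local Open Scope classical_set_scope.
Local Open Scope ring_scope.

Section Euclidean.
Context {R : realType} {n : nat}.
Implicit Types (u v x d : 'rV[R]_n) (f g : 'rV[R]_n -> R).

Definition dot u v : R := \sum_(i < n) u 0 i * v 0 i.

(* The norm `|u| of 'rV[R]_n is the sup norm; it induces the same topology,
   hence the same continuity and differentiability, as enorm. *)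
Definition enorm u : R := Num.sqrt (dot u u).

(* This is the gradient only where f is differentiable: 'D_v f x is a total
   function, whose value is arbitrary where the derivative does not exist. *)
Definition gradient f x : 'rV[R]_n := \row_(i < n) 'D_(delta_mx 0 i) f x.

Definition convex f := @convex_function R 'rV[R]_n setT f.

Definition weakly_convex (sigma : R) g :=
  0 < sigma /\ convex (fun x => g x + sigma / 2 * enorm x ^+ 2).

Definition proper_function (h : 'rV[R]_n -> \bar R) :=
  (exists x, (h x < +oo)%E) /\ (forall x, (-oo < h x)%E).

Definition directionally_differentiable g :=
  forall x d, cvg ((g (x + tau *: d) - g x) / tau @[tau --> 0^'+]).

Definition gradient_lipschitz (Lip : R) f :=
  forall x y, enorm (gradient f x - gradient f y) <= Lip * enorm (x - y).

Definition argmin (h : 'rV[R]_n -> R) : set 'rV[R]_n :=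
  [set x | forall y, h x <= h y].

End Euclidean.

Section LADMM.
Context {R : realType} {n : nat}.
Variables (f g : 'rV[R]_n -> R) (rho : R).

(* v is the scaled dual variable: the multiplier itself is rho *: v. *)
Definition aug_lagrangian (x z v : 'rV[R]_n) : R :=
  f z + g x + rho * dot v (x - z) + rho / 2 * enorm (x - z) ^+ 2.

Definition is_LADMM (x z v : nat -> 'rV[R]_n) :=
  forall t : nat,
  [/\ argmin (fun y => aug_lagrangian y (z t) (v t)) (x t.+1),
      argmin (fun w => f (z t) + dot (gradient f (z t)) (w - z t)
                       + rho / 2 * enorm (x t.+1 - w + v t) ^+ 2) (z t.+1) &
      v t.+1 = v t + x t.+1 - z t.+1].

(* Meaningful for t >= 1 only, since 0.-1 = 0. *)
Definition kappa (Lip : R) (x z v : nat -> 'rV[R]_n) (t : nat) : R :=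
  aug_lagrangian (x t) (z t) (v t) + Lip ^+ 2 * enorm (z t - z t.-1) ^+ 2.

End LADMM.

(* Main.v *)
Require Import Defs.
From mathcomp Require Import all_boot all_order all_algebra.
From mathcomp Require Import all_classical all_reals all_analysis.
From mathcomp Require Import ring lra.

Import Order.TTheory GRing.Theory Num.Theory.
Import numFieldNormedType.Exports.

Local Open Scope classical_set_scope.
Local Open Scope ring_scope.

(** The z-subproblem is an explicit quadratic whose unique minimizer turns the
    dual update into rho v^(t+1) = grad f(z^t) ([ladmm_dual_gradient]).  Hence
    the dual variable inherits the Lipschitz bound of the gradient
    ([dual_gap]):
      rho^2 |v^(t+2) - v^(t+1)|^2 <= Lip^2 |z^(t+1) - z^t|^2.

    Monotonicity ([kappa_decrease]).  One iteration changes the augmented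
    Lagrangian in three ways.
    - The x-step does not increase it, because x^(t+1) is a minimizer.
    - The z- and v-steps together change it by
        f(z^(t+1)) - f(z^t) - rho <v^(t+1), z^(t+1) - z^t>
          - rho/2 |z^(t+1) - z^t|^2 + rho |v^(t+1) - v^t|^2.
      Since rho v^(t+1) = grad f(z^t), the descent lemma ([descent]) bounds the
      first three terms by Lip/2 |z^(t+1) - z^t|^2.
    - The only increase, rho |v^(t+1) - v^t|^2, is at most
      Lip^2 / rho |z^t - z^(t-1)|^2, which the term
      Lip^2 |z^t - z^(t-1)|^2 of kappa_t pays for as soon as rho >= 1.
    What remains is the coefficient (Lip - rho)/2 + Lip^2 of
    |z^(t+1) - z^t|^2; it is nonpositive exactly when
    rho >= Lip (1 + 2 Lip).

    Lower bound ([kappa_ge_objective]).  With rho v^t = grad f(z^(t-1)), moving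
    f from z^t to x^t by the descent lemma gives
      kappa_t >= (f + g)(x^t) - <grad f(z^t) - grad f(z^(t-1)), x^t - z^t>
        + (rho - Lip)/2 |x^t - z^t|^2 + Lip^2 |z^t - z^(t-1)|^2,
    and Young's inequality absorbs the inner product when rho >= 1 + Lip. *)

Section DotProduct.
Context {R : realType} {n : nat}.
Implicit Types (u v w : 'rV[R]_n) (a : R).

Lemma dotC u v : dot u v = dot v u.
Proof. by apply: eq_bigr => i _; rewrite mulrC. Qed.

Lemma dotDl u v w : dot (u + v) w = dot u w + dot v w.
Proof. by rewrite -big_split; apply: eq_bigr => i _; rewrite mxE mulrDl. Qed.

Lemma dotZl a u v : dot (a *: u) v = a * dot u v.
Proof. by rewrite mulr_sumr; apply: eq_bigr => i _; rewrite mxE mulrA. Qed.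

Lemma dotNl u v : dot (- u) v = - dot u v.
Proof. by rewrite -scaleN1r dotZl mulN1r. Qed.

Lemma dotDr u v w : dot w (u + v) = dot w u + dot w v.
Proof. by rewrite dotC dotDl !(dotC w). Qed.

Lemma dotZr a u v : dot u (a *: v) = a * dot u v.
Proof. by rewrite dotC dotZl dotC. Qed.

Lemma dotNr u v : dot u (- v) = - dot u v.
Proof. by rewrite dotC dotNl dotC. Qed.

Definition dot_linE := (dotDl, dotDr, dotNl, dotNr, dotZl, dotZr).

Lemma dot_ge0 u : 0 <= dot u u.
Proof. by apply: sumr_ge0 => i _; rewrite -expr2 sqr_ge0. Qed.

Lemma dot_eq0 u : dot u u = 0 -> u = 0.
Proof.
move=> /psumr_eq0P u0; apply/rowP => i; rewrite mxE; apply/eqP.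
have /eqP := u0 (fun i _ => sqr_ge0 (u 0 i)) i isT.
by rewrite mulf_eq0 orbb.
Qed.

Lemma sqr_enorm u : enorm u ^+ 2 = dot u u.
Proof. by rewrite sqr_sqrtr // dot_ge0. Qed.

(** Young's inequality.  With the weight [a] free, it replaces Cauchy-Schwarz
    throughout, so that only squared norms ever occur. *)
Lemma dot_young a u v : 0 < a ->
  dot u v <= a^-1 / 2 * dot u u + a / 2 * dot v v.
Proof.
move=> a0; have an0 : a != 0 by rewrite gt_eqF.
have := dot_ge0 (u - a *: v); rewrite !dot_linE (dotC v u) => h.
rewrite -subr_ge0.
have -> : a^-1 / 2 * dot u u + a / 2 * dot v v - dot u v =
  a^-1 / 2 * (dot u u + - (a * dot u v) +
    (- (a * dot u v) + - - (a * (a * dot v v)))) by field.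
apply: mulr_ge0; last by lra.
by rewrite divr_ge0 // invr_ge0 ltW.
Qed.

End DotProduct.

Section Descent.
Context {R : realType} {n : nat}.
Implicit Types (f : 'rV[R]_n -> R) (y d : 'rV[R]_n).

(** At a point of differentiability the partial derivatives determine all the
    directional ones, by linearity of the differential. *)
Lemma derive_gradient f y d : differentiable f y ->
  'D_d f y = dot (gradient f y) d.
Proof.
move=> fy; rewrite deriveE // [in LHS](row_sum_delta d) linear_sum.
by apply: eq_bigr => i _; rewrite linearZ mxE deriveE // mulrC.
Qed.

Lemma is_derive_line f y d (s : R) : (forall y, differentiable f y) ->
  is_derive s 1 (fun r => f (y + r *: d)) (dot (gradient f (y + s *: d)) d).
Proof.
move=> fd.
(* The two difference quotients are the same function of the increment. *)
have quotE : (fun h : R => h^-1 *: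
    (((fun r => f (y + r *: d)) \o shift s) (h *: 1) - f (y + s *: d))) =
  (fun h : R => h^-1 *:
    ((f \o shift (y + s *: d)) (h *: d) - f (y + s *: d))).
  apply/funext => h /=; congr (_ *: (f _ - _)).
  by rewrite scalerDl [h *: 1]mulr1 addrCA.
apply: DeriveDef.
  rewrite /derivable quotE; exact: diff_derivable.
rewrite -derive_gradient // /derive; by rewrite quotE.
Qed.

Lemma gradient_lipschitz_dot f (Lip : R) y y' : 0 <= Lip ->
  gradient_lipschitz Lip f ->
  dot (gradient f y - gradient f y') (gradient f y - gradient f y') <=
    Lip ^+ 2 * dot (y - y') (y - y').
Proof.
move=> Lip0 /(_ y y') fl; rewrite -!sqr_enorm -exprMn.
by rewrite ler_sqr // nnegrE ?mulr_ge0 // sqrtr_ge0.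
Qed.

(** The descent lemma.  The remainder
      phi(s) = f(y + s d) - s <grad f(y), d> - s^2 Lip/2 |d|^2
    satisfies phi(1) <= phi(0) by the mean value theorem, since
    phi'(s) = <grad f(y + s d) - grad f(y), d> - s Lip |d|^2 <= 0 on
    the interval (0, 1). *)
Lemma descent f (Lip : R) y d :
  (forall y, differentiable f y) -> 0 < Lip -> gradient_lipschitz Lip f ->
  f (y + d) <= f y + dot (gradient f y) d + Lip / 2 * dot d d.
Proof.
move=> fd Lip0 fl.
pose phi (s : R) := f (y + s *: d)
  - (s * dot (gradient f y) d + s ^+ 2 * (Lip / 2 * dot d d)).
have dphi (s : R) : is_derive s 1 phi
    (dot (gradient f (y + s *: d)) d
       - (dot (gradient f y) d + s * (Lip * dot d d))).
  have dline := is_derive_line f y d s fd.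
  rewrite /phi; apply: is_derive_eq.
  by congr (_ - _); rewrite /GRing.scale /=; field.
have phi_cont : {within `[0, 1], continuous phi}.
  apply: continuous_subspaceT => r; apply: differentiable_continuous.
  by apply/derivable1_diffP; case: (dphi r).
have [s /[!in_itv]/= /andP[s0 s1]] := MVT ltr01 (fun s _ => dphi s) phi_cont.
rewrite /phi scale0r scale1r addr0 subr0 mulr1 => phi01.
(* The weight Lip * s balances the two terms of Young's inequality: each is
   then at most half of Lip * s * dot d d. *)
have := dot_young (Lip * s) (gradient f (y + s *: d) - gradient f y) d
  (mulr_gt0 Lip0 s0).
have := gradient_lipschitz_dot f Lip (y + s *: d) y (ltW Lip0) fl.
rewrite addrAC subrr add0r (dotZl s) (dotZr s).
set G := dot (_ - _) (_ - _) => Gle; rewrite dotDl dotNl => young.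
have : (Lip * s)^-1 / 2 * G <= Lip * s / 2 * dot d d.
  have -> : Lip * s / 2 * dot d d =
    (Lip * s)^-1 / 2 * (Lip ^+ 2 * (s * (s * dot d d))).
    by field; rewrite !gt_eqF.
  by rewrite ler_pM2l // divr_gt0 // invr_gt0 mulr_gt0.
lra.
Qed.

End Descent.

Section Ladmm.
Context {R : realType} {n : nat}.
Variables (f g : 'rV[R]_n -> R) (Lip rho : R) (x z v : nat -> 'rV[R]_n).
Hypotheses (f_diff : forall y, differentiable f y) (Lip0 : 0 < Lip).
Hypotheses (f_lip : gradient_lipschitz Lip f) (rho0 : 0 < rho).
Hypothesis ladmm : is_LADMM f g rho x z v.

(** In the variable w the z-subproblem is, up to a constant, rho/2 times the
    squared distance to x^(t+1) + v^t - grad f(z^t) / rho.  So z^(t+1) is that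
    point, and the dual update cancels everything but the gradient. *)
Lemma ladmm_dual_gradient t : rho *: v t.+1 = gradient f (z t).
Proof.
have [_ zmin ->] := ladmm t.
have [q pE] : exists q, gradient f (z t) = rho *: q.
  exists (rho^-1 *: gradient f (z t)).
  by rewrite scalerA divff ?gt_eqF // scale1r.
rewrite pE in zmin *.
pose w := x t.+1 + v t - q; pose e := z t.+1 - w.
suff /dot_eq0/subr0_eq -> : dot e e = 0 by rewrite /w (addrC (v t)) subKr.
apply/eqP; rewrite eq_le dot_ge0 andbT -(pmulr_rle0 _ rho0).
have := zmin w; rewrite !sqr_enorm.
have -> : x t.+1 - w + v t = q by rewrite /w addrAC subKr.
have -> : x t.+1 - z t.+1 + v t = q - e.
  by rewrite /e /w; apply/rowP => i; rewrite !mxE; ring.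
have -> : z t.+1 - z t = (w - z t) + e.
  by rewrite /e; apply/rowP => i; rewrite !mxE; ring.
move: (w - z t) e => r e; rewrite !dot_linE (dotC e q).
lra.
Qed.

Lemma dual_gap t : rho ^+ 2 * dot (v t.+2 - v t.+1) (v t.+2 - v t.+1) <=
  Lip ^+ 2 * dot (z t.+1 - z t) (z t.+1 - z t).
Proof.
apply: le_trans (gradient_lipschitz_dot f Lip _ _ (ltW Lip0) f_lip).
by rewrite -!ladmm_dual_gradient -scalerBr dotZl dotZr mulrA.
Qed.

(** Pairing zp - zm with the new dual variable vp, rather than with vm, is what
    leaves the negative square - rho/2 |zp - zm|^2; and along the iteration
    rho vp is the gradient of f at zm, as the descent lemma requires. *)
Lemma aug_lagrangian_step (xp zp zm vm : 'rV[R]_n) :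
  let vp := vm + xp - zp in
  aug_lagrangian f g rho xp zp vp =
  aug_lagrangian f g rho xp zm vm + (f zp - f zm - rho * dot vp (zp - zm))
    - rho / 2 * dot (zp - zm) (zp - zm) + rho * dot (vp - vm) (vp - vm).
Proof.
move=> vp; rewrite /aug_lagrangian !sqr_enorm.
have -> : xp - zp = vp - vm.
  by rewrite /vp; apply/rowP => i; rewrite !mxE; ring.
have -> : xp - zm = (vp - vm) + (zp - zm).
  by rewrite /vp; apply/rowP => i; rewrite !mxE; ring.
move: (zp - zm) vp => e vp.
rewrite !(dotDl, dotDr, dotNl, dotNr) (dotC e) (dotC e) (dotC vm vp).
by field.
Qed.

Lemma kappa_decrease t : 1 <= rho -> Lip * (1 + 2 * Lip) <= rho ->
  kappa f g rho Lip x z v t.+2 <= kappa f g rho Lip x z v t.+1.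
Proof.
move=> rho1 rhoLip; have [xmin _ vE] := ladmm t.+1.
rewrite /kappa /= !sqr_enorm.
have := aug_lagrangian_step (x t.+2) (z t.+2) (z t.+1) (v t.+1).
rewrite -vE /= => ->.
have := descent f Lip (z t.+1) (z t.+2 - z t.+1) f_diff Lip0 f_lip.
rewrite -ladmm_dual_gradient dotZl addrC subrK.
have := dual_gap t; have := xmin (x t.+1).
have := dot_ge0 (z t.+2 - z t.+1); have := dot_ge0 (v t.+2 - v t.+1).
set a := dot _ _; set e := dot (z _ - z _) (z _ - z _) => a0 e0.
set d := dot (z _ - z _) (z _ - z _) => H1 H2 H3.
have : rho * a <= rho ^+ 2 * a.
  by rewrite expr2 -mulrA ler_peMl // mulr_ge0 // ltW.
have : 0 <= (rho - Lip * (1 + 2 * Lip)) / 2 * e.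
  by rewrite mulr_ge0 // divr_ge0 // subr_ge0.
lra.
Qed.

Lemma kappa_ge_objective t : 1 + Lip <= rho ->
  f (x t.+1) + g (x t.+1) <= kappa f g rho Lip x z v t.+1.
Proof.
move=> rhoLip; rewrite /kappa /= /aug_lagrangian !sqr_enorm.
rewrite -(dotZl rho) ladmm_dual_gradient.
have := descent f Lip (z t.+1) (x t.+1 - z t.+1) f_diff Lip0 f_lip.
rewrite [in f (_ + _)]addrC subrK.
have := gradient_lipschitz_dot f Lip (z t.+1) (z t) (ltW Lip0) f_lip.
have := dot_young 1 (gradient f (z t.+1) - gradient f (z t))
  (x t.+1 - z t.+1) ltr01.
have := dot_ge0 (z t.+1 - z t); have := dot_ge0 (x t.+1 - z t.+1).
rewrite invr1; set G := dot (gradient _ _ - _) (gradient _ _ - _).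
set d := dot (z _ - z _) (z _ - z _).
move: (x t.+1 - z t.+1) => e; rewrite dotDl dotNl => e0 d0 H1 H2 H3.
have : 0 <= (rho - (1 + Lip)) / 2 * dot e e.
  by rewrite mulr_ge0 // divr_ge0 // subr_ge0.
have : 0 <= Lip ^+ 2 * d by rewrite mulr_ge0 // sqr_ge0.
lra.
Qed.

End Ladmm.

Theorem lemma3 (R : realType) (n : nat) (f g : 'rV[R]_n -> R)
  (sigma_g Lip rho : R) (x z v : nat -> 'rV[R]_n)
  (f_convex : convex f)
  (f_diff : forall y, differentiable f y)
  (zeta_lbound : has_lbound (range (fun y => f y + g y)))
  (g_proper : proper_function (EFin \o g))
  (g_lsc : lower_semicontinuous (EFin \o g))
  (g_wconvex : weakly_convex sigma_g g)
  (g_dirdiff : directionally_differentiable g)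
  (Lip_gt0 : 0 < Lip)
  (f_lip : gradient_lipschitz Lip f)
  (xzv_LADMM : is_LADMM f g rho x z v)
  (rho_gt : Num.max sigma_g (Num.max (1 + Lip) (Lip * (1 + 2 * Lip))) < rho) :
  (forall t : nat, (1 <= t)%N ->
     kappa f g rho Lip x z v t.+1 <= kappa f g rho Lip x z v t) /\
  has_lbound [set kappa f g rho Lip x z v t | t in [set t : nat | (1 <= t)%N]].
Proof.
move: rho_gt; rewrite !gt_max => /and3P[_ rhoLip1 rhoLip2].
have rho1 : 1 <= rho by lra.
have rho0 : 0 < rho by lra.
split=> [[//|t] _|].
  by apply: kappa_decrease => //; exact: ltW.
have [m mlb] := zeta_lbound.
exists m => _ [[//|t] _ <-].
apply: (@le_trans _ _ (f (x t.+1) + g (x t.+1))).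
  by apply: mlb; exists (x t.+1).
by apply: kappa_ge_objective => //; exact: ltW.
Qed.
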